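(* Let $(L_i)_{i=1}^n$ be a sequence of Markov generators with $L_i\in\mathcal{L}$ for each $i=1,\ldots,n$. Write $P_p(L_i)$ for the power mean reversiblization of $L_i$ with index $p$. All formulas below are for $x\neq y\in\mathcal{X}$. (1) ($\alpha$-divergence) Let $f(t)=\frac{t^\alpha-\alpha t-(1-\alpha)}{\alpha(\alpha-1)}$ for $\alpha\in\mathbb{R}\setminus\{0,1\}$. The unique $f$-projection centroid $M^f_n$ and the unique $f^*$-projection centroid $M^{f^*}_n$ are given by $$M^f_n(x,y)=\left(\frac1n\sum_{i=1}^n\left(M^f(L_i,\pi)(x,y)\right)^{1-\alpha}\right)^{1/(1-\alpha)},\qquad M^{f^*}_n(x,y)=\left(\frac1n\sum_{i=1}^n\left(M^{f^*}(L_i,\pi)(x,y)\right)^{\alpha}\right)^{1/\alpha},$$ where $M^f(L_i,\pi)=P_{1-\alpha}(L_i)$ and $M^{f^*}(L_i,\pi)=P_\alpha(L_i)$. (2) ($\chi^2$-divergence) Let $f(t)=(t-1)^2$. The unique $f$-projection centroid and the unique $f^*$-projection centroid are given by $$M^f_n(x,y)=\left(\frac1n\sum_{i=1}^n\left(M^f(L_i,\pi)(x,y)\right)^{-1}\right)^{-1},\qquad M^{f^*}_n(x,y)=\left(\frac1n\sum_{i=1}^n\left(M^{f^*}(L_i,\pi)(x,y)\right)^{2}\right)^{1/2},$$ where $M^f(L_i,\pi)=P_{-1}(L_i)$ and $M^{f^*}(L_i,\pi)=P_2(L_i)$. (3) (squared Hellinger distance) Let $f(t)=(\sqrt t-1)^2$.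 The unique $f$-projection centroid and the unique $f^*$-projection centroid are given by $$M^f_n(x,y)=\left(\frac1n\sum_{i=1}^n\sqrt{M^f(L_i,\pi)(x,y)}\right)^2,\qquad M^{f^*}_n(x,y)=\left(\frac1n\sum_{i=1}^n\sqrt{M^{f^*}(L_i,\pi)(x,y)}\right)^2,$$ where $M^f(L_i,\pi)=M^{f^*}(L_i,\pi)=P_{1/2}(L_i)$. (4) (Kullback-Leibler divergence) Let $f(t)=t\ln t-t+1$. The unique $f$-projection centroid and the unique $f^*$-projection centroid are given by $$M^f_n(x,y)=\left(\prod_{i=1}^nM^f(L_i,\pi)(x,y)\right)^{1/n},\qquad M^{f^*}_n(x,y)=\frac1n\sum_{i=1}^nM^{f^*}(L_i,\pi)(x,y),$$ where $M^f(L_i,\pi)=P_0(L_i)$ and $M^{f^*}(L_i,\pi)=P_1(L_i)$.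
   Context: $\mathcal{X}$ is a finite set and $\pi$ is a fixed probability distribution on $\mathcal{X}$ with $\pi(x)>0$ for all $x$. $\mathcal{L}$ is the set of Markov infinitesimal generators on $\mathcal{X}$, i.e. $\mathcal{X}\times\mathcal{X}$ real matrices with non-negative off-diagonal entries and all row sums zero. $\mathcal{L}(\pi)\subseteq\mathcal{L}$ is the set of $\pi$-reversible generators, i.e. those $M$ with $\pi(x)M(x,y)=\pi(y)M(y,x)$ for all $x,y$. The $\pi$-dual $L_\pi$ of $L\in\mathcal{L}$ is the generator with off-diagonal entries $L_\pi(x,y)=\frac{\pi(y)}{\pi(x)}L(y,x)$, $x\neq y$, and diagonal entries such that all row sums are zero. For $M,L\in\mathcal{L}$ and convex $f$ with $f(1)=0$, the $f$-divergence is $$D_f(M\|L):=\sum_{x\in\mathcal{X}}\pi(x)\sum_{y\in\mathcal{X}\setminus\{x\}}L(x,y)\,f\!\left(\frac{M(x,y)}{L(x,y)}\right),$$ with the convention $0f(a/0)=0$ for $a\ge 0$ (and $f(0)$ the limit as $t\to0^+$, possibly $+\infty$). The $f$-projection and $f^*$-projection of $L$ are $M^f(L,\pi)=\arg\min_{M\in\mathcal{L}(\pi)}D_f(M\|L)$ and $M^{f^*}(L,\pi)=\arg\min_{M\in\mathcal{L}(\pi)}D_f(L\|M)$. The $f$-projection centroid and $f^*$-projection centroid of $(L_i)_{i=1}^n$ are $$M^f_n=\arg\min_{M\in\mathcal{L}(\pi)}\sum_{i=1}^nD_f(M\|L_i),\qquad M^{f^*}_n=\arg\min_{M\in\mathcal{L}(\pi)}\sum_{i=1}^nD_f(L_i\|M).$$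 Power mean reversiblizations of $L$: for $x\neq y$, $P_p(x,y)=\left(\frac{L(x,y)^p+L_\pi(x,y)^p}{2}\right)^{1/p}$ for $p\in\mathbb{R}\setminus\{0\}$ and $P_0(x,y)=\sqrt{L(x,y)L_\pi(x,y)}$; diagonal entries are such that all row sums are zero. Means with negative exponent are understood by continuity as $0$ when one of the averaged entries is $0$.
   Formalization: For a > 0 the convention 0f(a/0) = 0 is replaced by 0f(a/0) = a·lim f(s)/s as s→∞ (0f(0/0) = 0 is kept); with the original convention the zero generator would always minimize D_f(L‖·), so the f*-formulas, and the f-formulas when L has zero entries, would fail. *)

(* Defs.v *)
From HB Require Import structures.
From mathcomp Require Import all_boot all_order all_algebra.
From mathcomp Require Import all_classical all_reals all_analysis.

Set Implicit Arguments.
Unset Strict Implicit.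
Unset Printing Implicit Defensive.

Import Order.TTheory GRing.Theory Num.Theory.
Import numFieldNormedType.Exports.

Local Open Scope classical_set_scope.
Local Open Scope ring_scope.

Section Generators.
Context {R : realType} {X : finType}.
Implicit Types (pi : X -> R) (M L off : X -> X -> R).

Definition generators : set (X -> X -> R) :=
  [set M | (forall x y, x != y -> 0 <= M x y) /\
           (forall x, \sum_(y : X) M x y = 0)].

Definition reversible_generators pi : set (X -> X -> R) :=
  [set M | generators M /\ forall x y, pi x * M x y = pi y * M y x].

(* The matrix with zero row sums and the off-diagonal entries of [off]; the
   diagonal of [off] is ignored. *)
Definition with_zero_row_sums off : X -> X -> R :=
  fun x y => if x == y then - \sum_(z : X | z != x) off x z else off x y.

Definition dual pi L : X -> X -> R :=
  with_zero_row_sums (fun x y => pi y / pi x * L y x).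

(* For p < 0 the value is 0, the continuous extension, as soon as one of the
   two entries is 0.  (The library sets 0 `^ p = 0 for every p != 0, so the
   formula alone would give another value.) *)
Definition power_reversiblization pi (p : R) L : X -> X -> R :=
  with_zero_row_sums (fun x y =>
    if p == 0 then Num.sqrt (L x y * dual pi L x y)
    else if (p < 0) && ((L x y == 0) || (dual pi L x y == 0)) then 0
    else ((L x y `^ p + dual pi L x y `^ p) / 2) `^ p^-1).

End Generators.

(* For p != 0; same convention as above for p < 0. *)
Definition power_mean {R : realType} {n : nat} (p : R) (a : 'I_n -> R) : R :=
  if (p < 0) && [exists i, a i == 0] then 0
  else (n%:R^-1 * \sum_(i < n) a i `^ p) `^ p^-1.

Section Divergence.
Context {R : realType} {X : finType}.
Implicit Types (f : R -> R) (pi : X -> R) (M L : X -> X -> R).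
Local Open Scope ereal_scope.

(* f on [0, +oo[, where f(0) is the limit at 0+, possibly +oo, whatever value
   the function f takes at 0. *)
Definition value_ext f (t : R) : \bar R :=
  if t == 0%R then lim ((f s)%:E @[s --> 0^'+]) else (f t)%:E.

Definition slope_at_infinity f : \bar R :=
  lim ((f s / s)%:E @[s --> +oo%R]).

(* b f(a / b) for a, b >= 0, extended to b = 0 by
     0 f(a / 0) = a * lim_(s -> +oo) f(s) / s,
   the limit of b f(a / b) as b -> 0+.  In particular 0 f(0 / 0) = 0, since
   0 * +oo = 0 in the extended reals of the library.  Setting 0 f(a / 0) = 0
   also for a > 0 would give fdiv f pi L 0 = 0 for every f and L, so that the
   zero generator would minimize fdiv f pi L for every nonnegative f. *)
Definition perspective f (a b : R) : \bar R :=
  if b == 0%R then a%:E * slope_at_infinity f else b%:E * value_ext f (a / b).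

(* D_f(M || L) *)
Definition fdiv f pi M L : \bar R :=
  \sum_(x : X) (pi x)%:E * \sum_(y : X | y != x) perspective f (M x y) (L x y).

Definition argmin {T : Type} (A : set T) (F : T -> \bar R) : set T :=
  [set M | A M /\ forall N, A N -> F M <= F N].

Definition f_projections f pi L : set (X -> X -> R) :=
  argmin (reversible_generators pi) (fun M => fdiv f pi M L).

Definition fstar_projections f pi L : set (X -> X -> R) :=
  argmin (reversible_generators pi) (fun M => fdiv f pi L M).

Definition f_centroids f pi n (L : 'I_n -> X -> X -> R) : set (X -> X -> R) :=
  argmin (reversible_generators pi) (fun M => \sum_(i < n) fdiv f pi M (L i)).

Definition fstar_centroids f pi n (L : 'I_n -> X -> X -> R) :
    set (X -> X -> R) :=
  argmin (reversible_generators pi) (fun M => \sum_(i < n) fdiv f pi (L i) M).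

End Divergence.

Section DivergenceFunctions.
Context {R : realType}.

Definition alpha_fun (alpha t : R) : R :=
  (t `^ alpha - alpha * t - (1 - alpha)) / (alpha * (alpha - 1)).

Definition chi2_fun (t : R) : R := (t - 1) ^+ 2.

Definition hellinger_fun (t : R) : R := (Num.sqrt t - 1) ^+ 2.

Definition kl_fun (t : R) : R := t * ln t - t + 1.

End DivergenceFunctions.

(* Main.v *)
Require Import Defs.
From HB Require Import structures.
From mathcomp Require Import all_boot all_order all_algebra.
From mathcomp Require Import all_classical all_reals all_analysis.
From mathcomp Require Import ring lra.

Import Order.TTheory GRing.Theory Num.Theory.
Import numFieldNormedType.Exports.

Local Open Scope classical_set_scope.
Local Open Scope ring_scope.

Set Implicit Arguments.
Unset Strict Implicit.
Unset Printing Implicit Defensive.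

(** Let [d a b] be the extended perspective b f(a / b), or the same function
    with its arguments exchanged, which is the perspective of t f(1 / t).  For
    each of the functions f considered here [d] is nonnegative, vanishes exactly
    on the diagonal, is homogeneous of degree 1, and satisfies a compensation
    identity: to every nonempty finite family [s] of nonnegative numbers there belongs
    a number [c], its [barycenter], with

      sum_(b in s) d m b = (size s) * d m c + sum_(b in s) d c b

    for all [m >= 0], the last sum being finite.  Up to a factor and
    an additive constant, sum_b d m b is thus d m c, whose only minimizer is
    [c].  The barycenter is
    the power mean of exponent 1 - alpha for f_alpha ([barycenter_power]), the
    geometric mean for the Kullback-Leibler divergence ([barycenter_kl]), and
    the arithmetic mean for its reverse ([barycenter_kl_swap]).

    Reversibility turns the minimization over generators into one problem of
    this kind for each pair of states.  If M is reversible, homogeneity gives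

      pi y * d (M y x) (L y x) = pi x * d (M x y) (L_pi x y),

    so twice the divergence of M from L is the sum over x != y of
    pi x * (d (M x y) (L x y) + d (M x y) (L_pi x y)).  With P x y the
    barycenter of L x y and L_pi x y, the compensation identity becomes the
    Pythagorean identity D(M, L) = D(M, P) + D(P, L) ([pythagoras]).  As
    D(P, L) is finite, P is the unique projection of L.

    For several generators, D(M, L_i) may be replaced by D(M, P_i), and a
    second use of the compensation identity, for the family P_i x y with x and
    y fixed, gives sum_i D(M, P_i) = n * D(M, C) + constant, where C x y is the
    barycenter of the P_i x y.  Hence C is the unique centroid
    ([centroid_of_projections]).

    The chi^2 function is 2 f_2 and the Hellinger function is f_(1/2) / 2 on
    the positive numbers, and exchanging the arguments of the perspective of
    f_alpha gives the perspective of f_(1 - alpha).  All cases but the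
    Kullback-Leibler one are therefore covered by one statement about
    multiples of f_alpha, [power_projections_centroids]. *)

(** * Divergences of two numbers and barycenters *)

Section AbstractDivergence.
Context {R : realType}.
Implicit Types (d : R -> R -> \bar R) (a b c m t : R) (s : seq R).
Local Open Scope ereal_scope.

(** The conditions concern nonnegative arguments, where perspectives are given
    by closed formulas. *)
Record divergence d : Prop := Divergence {
  divergence_ge0 : forall a b, (0 <= a)%R -> (0 <= b)%R -> 0 <= d a b;
  divergence_eq0 : forall a b, (0 <= a)%R -> (0 <= b)%R ->
    d a b = 0 <-> a = b;
  divergenceZ : forall t a b, (0 < t)%R -> (0 <= a)%R -> (0 <= b)%R ->
    d (t * a)%R (t * b)%R = t%:E * d a b }.

Lemma divergence_refl d : divergence d -> forall a, (0 <= a)%R -> d a a = 0.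
Proof. by move=> dP a a0; apply/(divergence_eq0 dP). Qed.

(** Asking for the compensation identity rather than for minimality makes
    barycenters compose: the identity for the parts of a family can be summed,
    which is what lets a centroid be computed from the projections. *)
Record barycenter d s c : Prop := Barycenter {
  barycenter_ge0 : (0 <= c)%R;
  barycenter_fin : \sum_(b <- s) d c b \is a fin_num;
  barycenterE : forall m, (0 <= m)%R ->
    \sum_(b <- s) d m b = (size s)%:R%:E * d m c + \sum_(b <- s) d c b }.

Lemma barycenter_perm d s1 s2 c :
  perm_eq s1 s2 -> barycenter d s1 c -> barycenter d s2 c.
Proof.
move=> s12 [c0 fin E]; split=> //.
  by rewrite -(perm_big _ s12).
by move=> m m0; rewrite -(perm_size s12) -!(perm_big _ s12) /= E.
Qed.

Lemma barycenter_scale d s c t : divergence d ->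
  (forall b, b \in s -> (0 <= b)%R) -> (0 < t)%R ->
  barycenter d s c -> barycenter d [seq (t * b)%R | b <- s] (t * c)%R.
Proof.
move=> dP s0 t0 [c0 fin E].
have sumZ m : (0 <= m)%R ->
    \sum_(b <- [seq (t * b)%R | b <- s]) d (t * m)%R b =
    t%:E * \sum_(b <- s) d m b.
  move=> m0; rewrite big_map [RHS](_ : _ = t%:E * \sum_(b <- s | b \in s) d m b).
    rewrite ge0_sume_distrr => [|b /s0 b0]; last exact: (divergence_ge0 dP).
    by rewrite big_seq; apply: eq_bigr => b /s0 b0; rewrite (divergenceZ dP).
  by rewrite -big_seq.
split.
- exact: mulr_ge0 (ltW t0) c0.
- by rewrite sumZ// fin_numM.
move=> m m0; have -> : m = (t * (m / t))%R by field; rewrite gt_eqF.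
have mt0 : (0 <= m / t)%R by rewrite divr_ge0 ?(ltW t0).
rewrite !sumZ// E// size_map (divergenceZ dP)//.
rewrite muleDr ?fin_num_adde_defl//.
by rewrite muleCA.
Qed.

(** Writing the identity of each of the two barycenters at the other one shows
    that their residual sums bound each other, so that the distance between
    them vanishes. *)
Lemma barycenter_unique d s c1 c2 : divergence d -> s != [::] ->
  barycenter d s c1 -> barycenter d s c2 -> c1 = c2.
Proof.
move=> dP; case: s => [//|a s] _ [c10 fin1 E1] [c20 fin2 E2].
have := E1 _ c20; have := E2 _ c10.
move: fin1 fin2; set A := \sum_(_ <- _) _; set B := \sum_(_ <- _) _ => Afin Bfin AE BE.
have d12 := divergence_ge0 dP c10 c20.
have d21 := divergence_ge0 dP c20 c10.
have leAB : A <= B by rewrite BE leeDr// mule_ge0.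
have leBA : B <= A by rewrite AE leeDr// mule_ge0.
have AB : A = B by apply/eqP; rewrite eq_le leAB leBA.
have /eqP : (size s).+1%:R%:E * d c2 c1 = 0.
  by rewrite -(addeK (_%:E * d c2 c1) Afin) -BE AB subee.
rewrite mule_eq0 eqe pnatr_eq0/= => /eqP.
by move/(divergence_eq0 dP c20 c10).
Qed.

End AbstractDivergence.

(** * Pythagorean identity for reversible generators *)

Section ReversibleGenerators.
Context {R : realType} {X : finType}.
Implicit Types (d : R -> R -> \bar R) (pi : X -> R) (M N L P : X -> X -> R).
Local Open Scope ereal_scope.

Definition total_divergence d pi M L : \bar R :=
  \sum_(x : X) (pi x)%:E * \sum_(y : X | y != x) d (M x y) (L x y).

Lemma generators_offdiag_ge0 L :
  generators L -> forall x y, y != x -> (0 <= L x y)%R.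
Proof. by case=> L0 _ x y yx; apply: L0; rewrite eq_sym. Qed.

Lemma dual_offdiag pi L x y :
  y != x -> dual pi L x y = (pi y / pi x * L y x)%R.
Proof. by rewrite /dual /with_zero_row_sums eq_sym => /negPf ->. Qed.

Lemma dual_offdiag_ge0 pi L : (forall x, (0 < pi x)%R) -> generators L ->
  forall x y, y != x -> (0 <= dual pi L x y)%R.
Proof.
move=> pi0 Lg x y yx; rewrite dual_offdiag// mulr_ge0 ?divr_ge0 ?(ltW (pi0 _))//.
by apply: (generators_offdiag_ge0 Lg); rewrite eq_sym.
Qed.

Lemma with_zero_row_sums_offdiag (off : X -> X -> R) x y :
  y != x -> with_zero_row_sums off x y = off x y.
Proof. by rewrite /with_zero_row_sums eq_sym => /negPf ->. Qed.

Lemma with_zero_row_sums_reversible pi (off : X -> X -> R) :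
  (forall x y, y != x -> (0 <= off x y)%R) ->
  (forall x y, y != x -> (pi x * off x y = pi y * off y x)%R) ->
  reversible_generators pi (with_zero_row_sums off).
Proof.
move=> off0 offE; split; [split|].
- by move=> x y; rewrite eq_sym => xy; rewrite with_zero_row_sums_offdiag ?off0.
- move=> x; rewrite (bigD1 x)//= {1}/with_zero_row_sums eqxx.
  under [X in (_ + X)%R]eq_bigr => y yx do rewrite with_zero_row_sums_offdiag//.
  by rewrite addNr.
- move=> x y; have [->//|xy] := eqVneq x y.
  have yx : y != x by rewrite eq_sym.
  by rewrite !with_zero_row_sums_offdiag//; apply: offE.
Qed.

Lemma generators_offdiag_inj M N : generators M -> generators N ->
  (forall x y, y != x -> M x y = N x y) -> M = N.
Proof.
move=> [_ M0] [_ N0] MN; apply/funext => x; apply/funext => y.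
have [->|yx] := eqVneq y x; last exact: MN.
have := M0 x; have := N0 x; rewrite !(bigD1 x (P := xpredT))//=.
under eq_bigr => z zx do rewrite -MN//.
by move=> /eqP + /eqP; rewrite !addr_eq0 => /eqP -> /eqP ->.
Qed.

Lemma total_divergenceE d pi M L : divergence d ->
  generators M -> generators L ->
  total_divergence d pi M L =
  \sum_(x : X) \sum_(y : X | y != x) (pi x)%:E * d (M x y) (L x y).
Proof.
move=> dP Mg Lg; apply: eq_bigr => x _; rewrite ge0_sume_distrr// => y yx.
by apply: (divergence_ge0 dP); apply: generators_offdiag_ge0.
Qed.

Lemma total_divergence_ge0 d pi M L : divergence d ->
  (forall x, (0 < pi x)%R) -> generators M -> generators L ->
  0 <= total_divergence d pi M L.
Proof.
move=> dP pi0 Mg Lg; apply: sume_ge0 => x _; apply: mule_ge0.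
  by rewrite lee_fin ltW.
apply: sume_ge0 => y yx.
by apply: (divergence_ge0 dP); apply: generators_offdiag_ge0.
Qed.

Lemma total_divergence_refl d pi M : divergence d -> generators M ->
  total_divergence d pi M M = 0.
Proof.
move=> dP Mg; rewrite /total_divergence big1// => x _.
rewrite big1 ?mule0// => y yx.
by rewrite (divergence_refl dP)//; apply: generators_offdiag_ge0.
Qed.

Lemma total_divergence_eq0 d pi M N : divergence d ->
  (forall x, (0 < pi x)%R) -> generators M -> generators N ->
  total_divergence d pi M N = 0 -> M = N.
Proof.
move=> dP pi0 Mg Ng /eqP.
have d0 x y : y != x -> 0 <= d (M x y) (N x y).
  by move=> yx; apply: (divergence_ge0 dP); apply: generators_offdiag_ge0.
rewrite seq_psume_eq0 => [|x _]; last first.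
  by apply: mule_ge0; [rewrite lee_fin ltW|apply: sume_ge0 => y; exact: d0].
move=> /allP sum0; apply: generators_offdiag_inj => // x y yx.
have /= := sum0 x (mem_index_enum _); rewrite mule_eq0 eqe gt_eqF//=.
rewrite seq_psume_eq0 => [/allP/(_ y (mem_index_enum _))|z]; last exact: d0.
rewrite yx/= => /eqP.
by move/(divergence_eq0 dP); apply; apply: generators_offdiag_ge0.
Qed.

Lemma exchange_offdiag (F : X -> X -> \bar R) :
  \sum_(x : X) \sum_(y : X | y != x) F x y =
  \sum_(x : X) \sum_(y : X | y != x) F y x.
Proof.
rewrite (exchange_big_dep xpredT)//=.
by apply: eq_bigr => x _; apply: eq_bigl => y; rewrite eq_sym.
Qed.

Lemma reversible_swap pi M : (forall x, (0 < pi x)%R) ->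
  reversible_generators pi M ->
  forall x y, M x y = (pi y / pi x * M y x)%R.
Proof.
move=> pi0 [_ rev] x y; rewrite -mulrAC -rev mulrAC mulfV ?mul1r//.
by rewrite gt_eqF.
Qed.

(** In one of the two copies of the sum, x and y are exchanged; balance and
    homogeneity with factor [pi y / pi x] then bring the term of (y, x) to the
    entry [M x y], at the price of replacing [L y x] by [dual pi L x y]. *)
Lemma total_divergence_symmetrized d pi M L : divergence d ->
  (forall x, (0 < pi x)%R) -> reversible_generators pi M -> generators L ->
  total_divergence d pi M L + total_divergence d pi M L =
  \sum_(x : X) \sum_(y : X | y != x)
    (pi x)%:E * \sum_(b <- [:: L x y; dual pi L x y]) d (M x y) b.
Proof.
move=> dP pi0 Mrev Lg; have [Mg _] := Mrev.
rewrite {2}total_divergenceE// exchange_offdiag total_divergenceE//.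
rewrite -big_split/=; apply: eq_bigr => x _; rewrite -big_split/=.
apply: eq_bigr => y yx; rewrite big_cons big_seq1.
have xy : x != y by rewrite eq_sym.
have pyx : (0 < pi y / pi x)%R by rewrite divr_gt0.
have M0 := generators_offdiag_ge0 Mg; have L0 := generators_offdiag_ge0 Lg.
rewrite ge0_muleDr; last 2 first.
  by apply: (divergence_ge0 dP); [apply: M0|apply: L0].
  by apply: (divergence_ge0 dP); [apply: M0|apply: dual_offdiag_ge0].
congr (_ + _); rewrite dual_offdiag// (reversible_swap pi0 Mrev x y).
rewrite (divergenceZ dP) ?M0 ?L0// muleA -EFinM.
by rewrite mulrCA mulfV ?mulr1// gt_eqF.
Qed.

Definition pairwise_barycenter d pi L P := forall x y, y != x ->
  barycenter d [:: L x y; dual pi L x y] (P x y).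

Lemma ereal_double_inj (u v : \bar R) : u + u = v + v -> u = v.
Proof.
case: u v => [u| |] [v| |]//= [] uv; congr (_%:E).
by apply: (@mulIf _ 2%R); rewrite ?pnatr_eq0// !mulr_natr.
Qed.

(** Applied to both [M] and [P], symmetrization reduces the claim to the
    compensation identity of each pair of states. *)
Lemma pythagoras d pi M L P : divergence d -> (forall x, (0 < pi x)%R) ->
  reversible_generators pi M -> reversible_generators pi P -> generators L ->
  pairwise_barycenter d pi L P ->
  total_divergence d pi M L =
  total_divergence d pi M P + total_divergence d pi P L.
Proof.
move=> dP pi0 Mrev Prev Lg bary; have [Mg _] := Mrev; have [Pg _] := Prev.
apply: ereal_double_inj; rewrite addeACA.
rewrite (total_divergence_symmetrized dP pi0 Mrev Lg).
rewrite (total_divergence_symmetrized dP pi0 Prev Lg).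
rewrite total_divergenceE// -!big_split/=.
apply: eq_bigr => x _; rewrite -!big_split/=.
apply: eq_bigr => y yx; have [P0 Pfin ->] := bary x y yx; last first.
  exact: generators_offdiag_ge0.
by rewrite muleDr ?fin_num_adde_defl// muleCA mule_natl mule2n.
Qed.

Lemma pairwise_barycenter_fin d pi L P : divergence d ->
  (forall x, (0 < pi x)%R) ->
  reversible_generators pi P -> generators L -> pairwise_barycenter d pi L P ->
  total_divergence d pi P L \is a fin_num.
Proof.
move=> dP pi0 Prev Lg bary.
suff : total_divergence d pi P L + total_divergence d pi P L \is a fin_num.
  by rewrite fin_numD => /andP[].
rewrite total_divergence_symmetrized//.
apply/sum_fin_numP => x _ _; apply/sum_fin_numP => y _ yx.
by rewrite fin_numM//; case: (bary x y yx).
Qed.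

(** A matrix of barycenters inherits the balance condition from the families
    whose barycenters it collects, because barycenters scale with their family
    and are unique. *)
Lemma barycenter_reversible d pi (S : X -> X -> seq R) (C : X -> X -> R) :
  divergence d -> (forall x, (0 < pi x)%R) ->
  (forall x y, y != x -> S x y != [::]) ->
  (forall x y, y != x -> forall b, b \in S x y -> (0 <= b)%R) ->
  (forall x y, y != x ->
    perm_eq [seq (pi x * b)%R | b <- S x y] [seq (pi y * b)%R | b <- S y x]) ->
  (forall x y, y != x -> barycenter d (S x y) (C x y)) ->
  reversible_generators pi (with_zero_row_sums C).
Proof.
move=> dP pi0 Sn0 Sge0 Sperm bary.
apply: with_zero_row_sums_reversible => x y yx; first by case: (bary _ _ yx).
have xy : x != y by rewrite eq_sym.
apply: (barycenter_unique (d := d) (s := [seq (pi x * b)%R | b <- S x y])) => //.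
- by rewrite -size_eq0 size_map size_eq0 Sn0.
- by apply: barycenter_scale => //; [apply: Sge0|apply: bary].
- apply: (barycenter_perm (s1 := [seq (pi y * b)%R | b <- S y x])).
    exact: Sperm.
  by apply: barycenter_scale => //; [apply: Sge0|apply: bary].
Qed.

Lemma pairwise_barycenter_reversible d pi L (C : X -> X -> R) :
  divergence d -> (forall x, (0 < pi x)%R) -> generators L ->
  pairwise_barycenter d pi L C ->
  reversible_generators pi (with_zero_row_sums C).
Proof.
move=> dP pi0 Lg.
apply: (barycenter_reversible (S := fun x y => [:: L x y; dual pi L x y])) => //.
- move=> x y yx b; rewrite !inE => /orP[] /eqP ->.
    exact: generators_offdiag_ge0.
  exact: dual_offdiag_ge0.
- move=> x y yx; have xy : x != y by rewrite eq_sym.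
  have scale z w a : (pi z * (pi w / pi z * a) = pi w * a)%R.
    by field; rewrite gt_eqF.
  by rewrite /= !dual_offdiag// !scale; apply/permP => p /=; rewrite addnCA.
Qed.

(** Finiteness of [K] is essential: with [K = +oo] every competitor would be a
    minimizer. *)
Lemma argmin_shifted_divergence d pi k (F : (X -> X -> R) -> \bar R) K C :
  divergence d -> (forall x, (0 < pi x)%R) ->
  (0 < k)%N -> K \is a fin_num -> reversible_generators pi C ->
  (forall M, reversible_generators pi M ->
    F M = k%:R%:E * total_divergence d pi M C + K) ->
  argmin (reversible_generators pi) F = [set C].
Proof.
move=> dP pi0 k0 Kfin Crev FE; have [Cg _] := Crev.
have FC : F C = K by rewrite FE// total_divergence_refl// mule0 add0e.
apply/seteqP; split => [M [Mrev Mmin]|_ ->]; last first.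
  split=> // N Nrev; rewrite FC FE// leeDr// mule_ge0//.
  by apply: total_divergence_ge0 => //; case: Nrev.
have [Mg _] := Mrev; have D0 := total_divergence_ge0 dP pi0 Mg Cg.
apply: (total_divergence_eq0 dP pi0) => //.
have := Mmin C Crev; rewrite FC FE// -[leRHS]add0e leeD2rE// => D_le0.
have /eqP : k%:R%:E * total_divergence d pi M C = 0.
  by apply/eqP; rewrite eq_le D_le0 mule_ge0.
by rewrite mule_eq0 eqe pnatr_eq0 eqn0Ngt k0 => /eqP.
Qed.

Lemma projection_pairwise_barycenter d pi L C : divergence d ->
  (forall x, (0 < pi x)%R) -> generators L -> pairwise_barycenter d pi L C ->
  argmin (reversible_generators pi) (fun M => total_divergence d pi M L) =
  [set with_zero_row_sums C].
Proof.
move=> dP pi0 Lg bary; set P := with_zero_row_sums C.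
have Prev : reversible_generators pi P by apply: pairwise_barycenter_reversible bary.
have baryP : pairwise_barycenter d pi L P.
  by move=> x y yx; rewrite /P with_zero_row_sums_offdiag//; apply: bary.
apply: (@argmin_shifted_divergence d pi 1 _ (total_divergence d pi P L)) => //.
  exact: pairwise_barycenter_fin.
by move=> M Mrev; rewrite mul1e; apply: pythagoras.
Qed.

Lemma centroid_barycenter d pi n (P : 'I_n -> X -> X -> R) C M :
  divergence d -> (forall x, (0 < pi x)%R) ->
  (forall i, generators (P i)) -> generators C -> generators M ->
  (forall x y, y != x -> barycenter d [seq P i x y | i <- enum 'I_n] (C x y)) ->
  \sum_(i < n) total_divergence d pi M (P i) =
  n%:R%:E * total_divergence d pi M C + \sum_(i < n) total_divergence d pi C (P i).
Proof.
move=> dP pi0 Pg Cg Mg bary.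
have swap N : generators N -> \sum_(i < n) total_divergence d pi N (P i) =
    \sum_(x : X) \sum_(y : X | y != x)
      (pi x)%:E * \sum_(b <- [seq P i x y | i <- enum 'I_n]) d (N x y) b.
  move=> Ng; under eq_bigr => i _ do rewrite total_divergenceE//.
  rewrite exchange_big/=; apply: eq_bigr => x _; rewrite exchange_big/=.
  apply: eq_bigr => y yx; rewrite big_map big_enum/= ge0_sume_distrr// => i _.
  by apply: (divergence_ge0 dP); apply: generators_offdiag_ge0.
have d0 x y : y != x -> 0 <= (pi x)%:E * d (M x y) (C x y).
  move=> yx; apply: mule_ge0; first by rewrite lee_fin ltW.
  by apply: (divergence_ge0 dP); apply: generators_offdiag_ge0.
rewrite !swap// total_divergenceE// ge0_sume_distrr => [|x _]; last first.
  by apply: sume_ge0 => y; apply: d0.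
rewrite -big_split/=; apply: eq_bigr => x _.
rewrite ge0_sume_distrr => [|y]; last exact: d0.
rewrite -big_split/=; apply: eq_bigr => y yx; have [C0 Cfin ->] := bary x y yx; last first.
  exact: generators_offdiag_ge0.
rewrite size_map size_enum_ord.
by rewrite muleDr ?fin_num_adde_defl// muleCA.
Qed.

(** The Pythagorean identity replaces each [L i] by [P i], after which the
    problem is the one of [centroid_barycenter]. *)
Lemma centroid_of_projections d pi n (L P : 'I_n -> X -> X -> R) C :
  divergence d -> (forall x, (0 < pi x)%R) -> (0 < n)%N ->
  (forall i, generators (L i)) ->
  (forall i, reversible_generators pi (P i)) ->
  (forall i, pairwise_barycenter d pi (L i) (P i)) ->
  (forall x y, y != x -> barycenter d [seq P i x y | i <- enum 'I_n] (C x y)) ->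
  argmin (reversible_generators pi)
    (fun M => \sum_(i < n) total_divergence d pi M (L i)) =
  [set with_zero_row_sums C].
Proof.
move=> dP pi0 n0 Lg Prev baryP baryC; set Q := with_zero_row_sums C.
have Pg i : generators (P i) by case: (Prev i).
have Qrev : reversible_generators pi Q.
  apply: (barycenter_reversible dP pi0 _ _ _ baryC).
  - by move=> x y _; rewrite -size_eq0 size_map size_enum_ord -lt0n.
  - move=> x y yx _ /mapP[i _ ->]; exact: generators_offdiag_ge0.
  - move=> x y _; rewrite -!map_comp (@eq_map _ _ _ ((fun b => pi y * b) \o (fun i => P i y x))%R)// => i /=.
    by case: (Prev i).
have baryQ x y : y != x -> barycenter d [seq P i x y | i <- enum 'I_n] (Q x y).
  by move=> yx; rewrite /Q with_zero_row_sums_offdiag//; apply: baryC.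
have [Qg _] := Qrev.
apply: (@argmin_shifted_divergence d pi n _
  (\sum_(i < n) total_divergence d pi Q (P i) +
   \sum_(i < n) total_divergence d pi (P i) (L i))) => //.
  rewrite fin_numD; apply/andP; split; apply/sum_fin_numP => i _ _; last first.
    exact: pairwise_barycenter_fin.
  apply/sum_fin_numP => x _ _; rewrite fin_numM//; apply/sum_fin_numP => y _ yx.
  have [_ + _] := baryQ x y yx; rewrite big_map big_enum => /sum_fin_numP; apply=> //.
move=> M Mrev; have [Mg _] := Mrev.
rewrite addeA -centroid_barycenter// -big_split/=.
by apply: eq_bigr => i _; apply: pythagoras.
Qed.

End ReversibleGenerators.

(** * Divergences with infinite values *)

Section ExtendedGaps.
Context {R : realType}.
Implicit Types (a b c m t alpha k p : R) (s : seq R).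

(** The perspectives studied below are given by one real formula [gap] wherever
    they are finite; [bad] tells where they are infinite. *)
Definition extended_gap (bad : rel R) (gap : R -> R -> R) a b : \bar R :=
  if bad a b then +oo%E else (gap a b)%:E.

Lemma divergence_extended_gap (bad : rel R) (gap : R -> R -> R) :
  (forall a, 0 <= a -> ~~ bad a a /\ gap a a = 0) ->
  (forall a b, 0 <= a -> 0 <= b -> ~~ bad a b -> a != b -> 0 < gap a b) ->
  (forall t a b, 0 < t -> 0 <= a -> 0 <= b ->
    bad (t * a) (t * b) = bad a b /\
    (~~ bad a b -> gap (t * a) (t * b) = t * gap a b)) ->
  divergence (extended_gap bad gap).
Proof.
move=> gap_refl gap_gt0 gapZ; rewrite /extended_gap.
have gap_ge0 a b : 0 <= a -> 0 <= b -> ~~ bad a b -> 0 <= gap a b.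
  move=> a0 b0 bad0; have [<-|ab] := eqVneq a b; first by case: (gap_refl a a0) => _ ->.
  exact/ltW/gap_gt0.
split=> [a b a0 b0|a b a0 b0|t a b t0 a0 b0].
- by case: ifPn => [_|bad0]; rewrite ?leey// lee_fin gap_ge0.
- split=> [|<-]; last by case: (gap_refl a a0) => /negPf -> ->.
  case: ifPn => // bad0 [gap0]; apply/eqP; apply: contraTT isT => ab.
  by have := gap_gt0 a b a0 b0 bad0 ab; rewrite gap0 ltxx.
- have [-> gapE] := gapZ t a b t0 a0 b0.
  by case: ifPn => [_|/gapE ->]; rewrite ?EFinM// gt0_muley.
Qed.

(** The condition on [has (bad m) s] says that both sides of the compensation
    identity are infinite at the same [m]; elsewhere it is an identity between
    real numbers. *)
Lemma barycenter_extended_gap (bad : rel R) (gap : R -> R -> R) s c :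
  s != [::] -> 0 <= c -> ~~ bad c c ->
  (forall m, 0 <= m -> has (bad m) s = bad m c) ->
  (forall m, 0 <= m -> ~~ bad m c ->
    \sum_(b <- s) gap m b = (size s)%:R * gap m c + \sum_(b <- s) gap c b) ->
  barycenter (extended_gap bad gap) s c.
Proof.
move=> s0 c0 badcc bad_s gap_s.
have sumE m : (\sum_(b <- s) extended_gap bad gap m b)%E =
    if has (bad m) s then +oo%E else (\sum_(b <- s) gap m b)%:E.
  elim: s {s0 bad_s gap_s} => [|b s IHs]; rewrite ?big_nil// !big_cons IHs /=.
  rewrite /extended_gap; case: (bad m b) => /=; last by case: ifP.
  by case: ifP.
split=> //; rewrite sumE bad_s// (negPf badcc)// => m m0.
rewrite sumE bad_s//; case: ifPn => badmc; last first.
  by rewrite gap_s// /extended_gap (negPf badmc).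
by rewrite /extended_gap badmc gt0_muley ?lte_fin ?ltr0n ?lt0n ?size_eq0.
Qed.

Lemma divergence_swap (d : R -> R -> \bar R) :
  divergence d -> divergence (fun a b => d b a).
Proof.
move=> dP; split=> [a b a0 b0|a b a0 b0|t a b t0 a0 b0].
- exact: (divergence_ge0 dP).
- by split=> [/(divergence_eq0 dP)->//|->]; apply: divergence_refl.
- exact: (divergenceZ dP).
Qed.

Lemma eq_divergence (d1 d2 : R -> R -> \bar R) :
  (forall a b, 0 <= a -> 0 <= b -> d1 a b = d2 a b) ->
  divergence d2 -> divergence d1.
Proof.
move=> d12 dP; split=> [a b a0 b0|a b a0 b0|t a b t0 a0 b0].
- by rewrite d12//; apply: (divergence_ge0 dP).
- by rewrite d12//; apply: (divergence_eq0 dP).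
- by rewrite !d12 ?(divergenceZ dP)// mulr_ge0// ltW.
Qed.

Lemma eq_barycenter (d1 d2 : R -> R -> \bar R) s c :
  (forall a b, 0 <= a -> 0 <= b -> d1 a b = d2 a b) ->
  (forall b, b \in s -> 0 <= b) ->
  barycenter d2 s c -> barycenter d1 s c.
Proof.
move=> d12 s0 [c0 fin E].
have sum12 m : 0 <= m -> (\sum_(b <- s) d1 m b = \sum_(b <- s) d2 m b)%E.
  by move=> m0; apply: eq_big_seq => b /s0 b0; rewrite d12.
by split=> //; [rewrite sum12|move=> m m0; rewrite !sum12// d12// E].
Qed.

End ExtendedGaps.

(** * The alpha-divergences and power means *)

Section PowerDivergence.
Context {R : realType}.
Implicit Types (a b c m t alpha k p : R) (s : seq R).

(** The weighted sum of two tangent inequalities at [t * a + (1 - t) * b], which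
    are strict because that point differs from both ends. *)
Lemma expR_strictly_convex t a b : 0 < t < 1 -> a != b ->
  expR (t * a + (1 - t) * b) < t * expR a + (1 - t) * expR b.
Proof.
move=> /andP[t0 t1] ab; set w := t * a + (1 - t) * b.
have tangent z : z != w -> expR w * (1 + (z - w)) < expR z.
  move=> zw; have -> : expR z = expR w * expR (z - w).
    by rewrite -expRD; congr expR; ring.
  by rewrite ltr_pM2l ?expR_gt0// expR_gt1Dx// subr_eq0.
have aw : a != w.
  rewrite -subr_eq0 (_ : a - w = (1 - t) * (a - b)); last by rewrite /w; ring.
  by rewrite mulf_neq0 ?subr_eq0// eq_sym lt_eqF.
have bw : b != w.
  rewrite -subr_eq0 (_ : b - w = t * (b - a)); last by rewrite /w; ring.
  by rewrite mulf_neq0 ?subr_eq0 ?(gt_eqF t0)// eq_sym.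
have ta := tangent a aw; have tb := tangent b bw.
have -> : expR w = t * (expR w * (1 + (a - w))) + (1 - t) * (expR w * (1 + (b - w))).
  by rewrite /w; ring.
by apply: ltrD; rewrite ltr_pM2l// subr_gt0.
Qed.

Definition power_infinite alpha : rel R := fun a b =>
  [&& alpha < 0, a == 0 & b != 0] || [&& 1 < alpha, b == 0 & a != 0].

(** This is b f(a / b) for f = k f_alpha and positive [a] and [b].  Since
    [0 `^ p = 0] for [p != 0], the formula is also right on the boundary
    wherever the perspective is finite there: for [a = 0] and [alpha > 0] it
    gives [k * b / alpha], for [b = 0] and [alpha < 1] it gives
    [k * a / (1 - alpha)]. *)
Definition power_gap k alpha a b : R :=
  k * ((a `^ alpha * b `^ (1 - alpha) - alpha * a - (1 - alpha) * b) /
       (alpha * (alpha - 1))).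

Definition power_divergence k alpha : R -> R -> \bar R :=
  extended_gap (power_infinite alpha) (power_gap k alpha).

Lemma power_infinite_swap alpha a b :
  power_infinite (1 - alpha) b a = power_infinite alpha a b.
Proof.
rewrite /power_infinite subr_lt0 orbC.
by have -> : (1 < 1 - alpha) = (alpha < 0) by apply/idP/idP; lra.
Qed.

Lemma power_gap_swap k alpha a b :
  power_gap k (1 - alpha) b a = power_gap k alpha a b.
Proof. by rewrite /power_gap subKr; congr (_ * (_ / _)); ring. Qed.

Lemma power_divergence_swap k alpha a b :
  power_divergence k (1 - alpha) b a = power_divergence k alpha a b.
Proof.
by rewrite /power_divergence /extended_gap power_infinite_swap power_gap_swap.
Qed.

Lemma powR_complement a alpha : 0 <= a -> a `^ alpha * a `^ (1 - alpha) = a.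
Proof.
move=> a0; rewrite -powRD; first by rewrite addrC subrK powRr1.
by rewrite addrC subrK oner_eq0.
Qed.

Lemma power_gap_refl k alpha a : 0 <= a -> power_gap k alpha a a = 0.
Proof.
move=> a0; rewrite /power_gap powR_complement//.
by rewrite (_ : a - _ - _ = 0) ?mul0r ?mulr0//; ring.
Qed.

Lemma powR_expR a b alpha : 0 < a -> 0 < b ->
  a `^ alpha * b `^ (1 - alpha) = expR (alpha * ln a + (1 - alpha) * ln b).
Proof. by move=> a0 b0; rewrite expRD /powR !gt_eqF. Qed.

(** For positive arguments this is strict convexity of the exponential at the
    points [ln a] and [ln b]. *)
Lemma power_gap_gt0 k alpha a b : 0 < k -> alpha != 0 -> alpha != 1 ->
  0 <= a -> 0 <= b -> ~~ power_infinite alpha a b -> a != b ->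
  0 < power_gap k alpha a b.
Proof.
move=> k0.
(* The exchange of the arguments turns [alpha] into [1 - alpha], so that it
   is enough to treat [alpha >= 1/2]. *)
wlog alpha12 : alpha a b / 1 / 2 <= alpha.
  move=> wlg al0 al1 a0 b0; have [|al12] := leP (1 / 2) alpha; first by move/wlg; apply.
  rewrite -power_infinite_swap -power_gap_swap eq_sym; apply: wlg => //.
  - by lra.
  - by rewrite subr_eq0 eq_sym.
  - by rewrite -subr_eq0 (_ : 1 - alpha - 1 = - alpha) ?oppr_eq0//; ring.
move=> _ al1 a0 b0.
have al0 : 0 < alpha by lra.
rewrite /power_infinite ltNge (ltW al0)/= => bad0 ab.
rewrite /power_gap mulr_gt0//.
have [a00|an0] := eqVneq a 0.
  have bp : 0 < b by rewrite lt_def b0 andbT eq_sym -a00.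
  rewrite a00 powR0 ?gt_eqF// mul0r mulr0 !sub0r.
  rewrite (_ : _ / _ = b / alpha) ?divr_gt0//.
  by field; rewrite gt_eqF// subr_eq0 al1.
have [b00|bn0] := eqVneq b 0.
  move: bad0; rewrite b00 eqxx an0/= andbT -leNgt => al_le1.
  have al_lt1 : alpha < 1 by rewrite lt_neqAle al1.
  rewrite powR0; last by rewrite subr_eq0 eq_sym.
  rewrite (_ : _ / _ = a / (1 - alpha)).
    by rewrite divr_gt0 ?subr_gt0// lt_def an0.
  by field; rewrite !subr_eq0 eq_sym al1 gt_eqF.
have ap : 0 < a by rewrite lt_def an0.
have bp : 0 < b by rewrite lt_def bn0.
have lnab : ln a != ln b.
  by apply: contraNneq ab => /ln_inj -> //; rewrite posrE.
rewrite powR_expR//.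
have [al_lt1|al_gt1] := ltP alpha 1.
  have := @expR_strictly_convex alpha (ln a) (ln b).
  rewrite al0 al_lt1 !lnK ?posrE// => /(_ isT lnab) convex.
  by rewrite ltr_ndivlMr ?mul0r; [lra|rewrite pmulr_rlt0// subr_lt0].
have {}al_gt1 : 1 < alpha by rewrite lt_neqAle eq_sym al1.
(* [ln a] is the convex combination of weights [1 / alpha] and
   [1 - 1 / alpha] of the exponent and [ln b]. *)
set z := alpha * ln a + (1 - alpha) * ln b.
have zb : z != ln b.
  rewrite -subr_eq0 (_ : z - ln b = alpha * (ln a - ln b)); last by rewrite /z; ring.
  by rewrite mulf_neq0 ?subr_eq0// gt_eqF.
have := @expR_strictly_convex alpha^-1 z (ln b).
rewrite invr_gt0 al0 invf_lt1// al_gt1 => /(_ isT zb).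
rewrite (_ : _ + _ * ln b = ln a); last by rewrite /z; field; rewrite gt_eqF.
rewrite !lnK ?posrE// -(ltr_pM2l al0) => convex.
rewrite divr_gt0 ?mulr_gt0 ?subr_gt0//.
move: convex; rewrite mulrDr mulrA mulfV ?gt_eqF// mul1r mulrA mulrBr mulr1.
by rewrite mulfV ?gt_eqF//; lra.
Qed.

Lemma divergence_power k alpha : 0 < k -> alpha != 0 -> alpha != 1 ->
  divergence (power_divergence k alpha).
Proof.
move=> k0 al0 al1; apply: divergence_extended_gap.
- move=> a a0; rewrite power_gap_refl// /power_infinite.
  by case: (a == 0); rewrite /= ?andbF.
- by move=> a b; apply: power_gap_gt0.
- move=> t a b t0 a0 b0; rewrite /power_infinite !mulf_eq0 gt_eqF//=; split=> // _.
  rewrite /power_gap !powRM ?(ltW t0)//.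
  rewrite mulrACA powR_complement ?(ltW t0)//; field.
  by rewrite subr_eq0 al1 al0.
Qed.

Definition seq_power_mean p s : R :=
  if (p < 0) && (0 \in s) then 0
  else ((size s)%:R^-1 * \sum_(b <- s) b `^ p) `^ p^-1.

Lemma seq_power_mean_eq0 p s : p != 0 -> s != [::] ->
  (forall b, b \in s -> 0 <= b) ->
  (seq_power_mean p s == 0) =
  if p < 0 then 0 \in s else all (fun b => b == 0) s.
Proof.
move=> p0 s0 sge0; rewrite /seq_power_mean.
have sumE : ((size s)%:R^-1 * \sum_(b <- s) b `^ p) `^ p^-1 == 0 =
    all (fun b => b == 0) s.
  rewrite powR_eq0 invr_eq0 p0 andbT mulf_eq0 invr_eq0 pnatr_eq0 size_eq0.
  rewrite (negPf s0)/= psumr_eq0 => [|b _]; last exact: powR_ge0.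
  by apply: eq_all => b; rewrite powR_eq0 p0 andbT.
case: ltP => _ /=; last by rewrite sumE.
case: ifPn => [_|s00]; first by rewrite eqxx.
rewrite sumE; apply/negbTE.
case: s s0 s00 {sge0 sumE} => // b s _.
by rewrite inE negb_or /= eq_sym => /andP[/negPf ->].
Qed.

Lemma seq_power_mean_powR p s : p != 0 -> ~~ ((p < 0) && (0 \in s)) ->
  seq_power_mean p s `^ p = (size s)%:R^-1 * \sum_(b <- s) b `^ p.
Proof.
move=> p0 /negPf pos; rewrite /seq_power_mean pos -powRrM mulVf// powRr1//.
by rewrite mulr_ge0// sumr_ge0// => b _; apply: powR_ge0.
Qed.

Lemma sum_power_gap k alpha s m :
  \sum_(b <- s) power_gap k alpha m b =
  k * ((m `^ alpha * (\sum_(b <- s) b `^ (1 - alpha)) -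
        alpha * (m * (size s)%:R) - (1 - alpha) * \sum_(b <- s) b) /
       (alpha * (alpha - 1))).
Proof.
elim: s => [|b s IHs]; first by rewrite !big_nil/= !mulr0 !subr0 mul0r mulr0.
by rewrite !big_cons IHs /power_gap /= -natr1; ring.
Qed.

(** Summing the gaps over [s] gives an expression in m that depends on [s] only
    through the sum of the b `^ (1 - alpha), apart from a constant, so that [s]
    may be replaced by [size s] copies of the mean.  The mean vanishes exactly
    when it has to for the infinite values to agree. *)
Lemma barycenter_power k alpha s : alpha != 0 -> alpha != 1 -> s != [::] ->
  (forall b, b \in s -> 0 <= b) ->
  barycenter (power_divergence k alpha) s (seq_power_mean (1 - alpha) s).
Proof.
move=> al0 al1 s0 sge0; set c := seq_power_mean _ _.
have p0 : 1 - alpha != 0 by rewrite subr_eq0 eq_sym.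
have c0 : 0 <= c by rewrite /c /seq_power_mean; case: ifP => // _; apply: powR_ge0.
have c_eq0 : (c == 0) = _ := seq_power_mean_eq0 p0 s0 sge0.
apply: barycenter_extended_gap => //.
- by rewrite /power_infinite; case: (c == 0); rewrite /= ?andbF.
- move=> m m0; rewrite /power_infinite c_eq0 subr_lt0.
  have [al_lt0|al_ge0]/= := ltP alpha 0.
    have al_le1 : alpha <= 1 by lra.
    rewrite ltNge al_le1/= orbF.
    case: (m == 0) => /=; last by elim: s {s0 sge0 c c0 c_eq0}.
    by rewrite -has_predC; apply: eq_has => b /=; rewrite orbF.
  have [al_gt1|al_le1]/= := ltP 1 alpha; last by elim: s {s0 sge0 c c0 c_eq0}.
  case: (m == 0) => /=.
    by rewrite andbF; elim: s {s0 sge0 c c0 c_eq0} => //= b s ->; rewrite andbF.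
  by rewrite andbT -has_pred1; apply: eq_has => b /=; rewrite andbT.
- move=> m m0 badmc; have [->|mc] := eqVneq m c.
    by rewrite power_gap_refl// mulr0 add0r.
  have nosp : ~~ ((1 - alpha < 0) && (0 \in s)).
    apply: contraNN mc => /andP[al_gt1 s00].
    have c00 : c == 0 by rewrite c_eq0 al_gt1.
    move: badmc; rewrite /power_infinite c00 -subr_lt0 al_gt1/= orbC/=.
    by case: (eqVneq m 0) => // -> _; rewrite eq_sym.
  have cp := seq_power_mean_powR p0 nosp; rewrite -/c in cp.
  have {}cp : \sum_(b <- s) b `^ (1 - alpha) = (size s)%:R * c `^ (1 - alpha).
    by rewrite cp mulrA mulfV ?mul1r// pnatr_eq0 size_eq0.
  rewrite !sum_power_gap cp (mulrCA (c `^ alpha)) powR_complement//.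
  rewrite /power_gap; field.
  by rewrite subr_eq0 al1 al0.
Qed.

End PowerDivergence.

(** * The Kullback-Leibler divergence, geometric and arithmetic means *)

Section KullbackLeibler.
Context {R : realType}.
Implicit Types (a b c m t : R) (s : seq R).

Definition kl_infinite : rel R := fun a b => (b == 0) && (a != 0).

(** At [a = 0] the formula takes the value [b], which is b f(0+). *)
Definition kl_gap a b : R := a * (ln a - ln b) - a + b.

Definition kl_divergence : R -> R -> \bar R := extended_gap kl_infinite kl_gap.

Lemma kl_gap_refl a : kl_gap a a = 0.
Proof. by rewrite /kl_gap; ring. Qed.

Lemma divergence_kl : divergence kl_divergence.
Proof.
apply: divergence_extended_gap.
- by move=> a a0; rewrite kl_gap_refl /kl_infinite andbN.
- move=> a b a0 b0; rewrite /kl_infinite /kl_gap => badab ab.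
  have [a00|an0] := eqVneq a 0.
    by rewrite a00 mul0r subr0 add0r lt_def b0 -a00 eq_sym ab.
  have ap : 0 < a by rewrite lt_def an0.
  have bn0 : b != 0 by move: badab; rewrite an0 andbT.
  have bp : 0 < b by rewrite lt_def bn0.
  have lnab : ln b - ln a != 0.
    rewrite subr_eq0; apply: contraNneq ab => lnE.
    by apply/eqP; apply: ln_inj; rewrite ?posrE.
  have bE : b = a * expR (ln b - ln a).
    by rewrite expRD expRN !lnK ?posrE// mulrCA mulfV ?mulr1.
  have := expR_gt1Dx lnab; rewrite -(ltr_pM2l ap) -bE; lra.
- move=> t a b t0 a0 b0; rewrite /kl_infinite !mulf_eq0 gt_eqF//=; split=> //.
  rewrite /kl_gap; have [->|an0] := eqVneq a 0; first by move=> _; ring.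
  rewrite andbT => bn0.
  by rewrite !lnM ?posrE// ?lt_def ?an0 ?bn0//; ring.
Qed.

Definition seq_geometric_mean s : R := (\prod_(b <- s) b) `^ (size s)%:R^-1.

Definition seq_arithmetic_mean s : R := (size s)%:R^-1 * \sum_(b <- s) b.

Lemma ln_prod s : (forall b, b \in s -> 0 < b) ->
  ln (\prod_(b <- s) b) = \sum_(b <- s) ln b.
Proof.
elim: s => [|b s IHs] sgt0; first by rewrite !big_nil ln1.
have sgt0' b' : b' \in s -> 0 < b' by move=> bs; apply: sgt0; rewrite inE bs orbT.
rewrite !big_cons lnM ?IHs// posrE ?(sgt0 b (mem_head _ _))//.
by rewrite big_seq; elim/big_ind: _ => // u v; exact: mulr_gt0.
Qed.

Lemma sum_kl_gap s m : \sum_(b <- s) kl_gap m b =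
  m * ((size s)%:R * ln m - \sum_(b <- s) ln b) - (size s)%:R * m +
  \sum_(b <- s) b.
Proof.
elim: s => [|b s IHs]; first by rewrite !big_nil/=; ring.
by rewrite !big_cons IHs /kl_gap /= -natr1; ring.
Qed.

Lemma sum_kl_gap_swap s m : \sum_(b <- s) kl_gap b m =
  \sum_(b <- s) b * ln b - (\sum_(b <- s) b) * ln m - \sum_(b <- s) b +
  (size s)%:R * m.
Proof.
elim: s => [|b s IHs]; first by rewrite !big_nil/=; ring.
by rewrite !big_cons IHs /kl_gap /= -natr1; ring.
Qed.

(** The sum of the gaps depends on [s], apart from a constant, only through the
    sum of the logarithms, which determines the geometric mean. *)
Lemma barycenter_kl s : s != [::] -> (forall b, b \in s -> 0 <= b) ->
  barycenter kl_divergence s (seq_geometric_mean s).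
Proof.
move=> s0 sge0; set c := seq_geometric_mean s.
have N0 : (size s)%:R != 0 :> R by rewrite pnatr_eq0 size_eq0.
have c0 : 0 <= c by apply: powR_ge0.
have c_eq0 : (c == 0) = (0 \in s).
  by rewrite powR_eq0 invr_eq0 N0 andbT prodf_seq_eq0 -has_pred1.
apply: barycenter_extended_gap => //.
- by rewrite /kl_infinite andbN.
- move=> m m0; rewrite /kl_infinite c_eq0; case: (m == 0) => /=.
    by rewrite andbF; elim: s {s0 sge0 c N0 c0 c_eq0} => //= b s ->; rewrite andbF.
  by rewrite andbT -has_pred1; apply: eq_has => b /=; rewrite andbT.
- move=> m m0 badmc; have [->|mc] := eqVneq m c.
    by rewrite kl_gap_refl mulr0 add0r.
  have cn0 : c != 0.
    apply: contraNN mc => c00; move: badmc; rewrite /kl_infinite c00/= negbK.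
    by rewrite (eqP c00).
  have sgt0 b : b \in s -> 0 < b.
    move=> bs; rewrite lt_def sge0// andbT; apply: contraNneq cn0 => b0.
    by rewrite c_eq0 -b0.
  have lnc : \sum_(b <- s) ln b = (size s)%:R * ln c.
    by rewrite /c ln_powR ln_prod// mulrA mulfV ?mul1r.
  by rewrite !sum_kl_gap lnc /kl_gap; ring.
Qed.

(** With the arguments exchanged, the part of the sum that depends on [m]
    involves [s] only through its sum. *)
Lemma barycenter_kl_swap s : s != [::] -> (forall b, b \in s -> 0 <= b) ->
  barycenter (fun a b => kl_divergence b a) s (seq_arithmetic_mean s).
Proof.
move=> s0 sge0; set c := seq_arithmetic_mean s.
have N0 : (size s)%:R != 0 :> R by rewrite pnatr_eq0 size_eq0.
have sE : \sum_(b <- s) b = (size s)%:R * c by rewrite mulrA mulfV ?mul1r.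
have c0 : 0 <= c.
  by rewrite mulr_ge0 ?invr_ge0// big_seq sumr_ge0// => b /sge0.
have c_eq0 : (c == 0) = all (fun b => b == 0) s.
  rewrite mulf_eq0 invr_eq0 (negPf N0)/= big_seq psumr_eq0; last by move=> b /sge0.
  by apply: eq_in_all => b ->.
apply: (barycenter_extended_gap (bad := fun a b => kl_infinite b a)
  (gap := fun a b => kl_gap b a)) => //.
- by rewrite /kl_infinite andbN.
- move=> m m0; rewrite /kl_infinite c_eq0 -has_predC.
  by case: (m == 0) => //=; elim: s {s0 sge0 c N0 sE c0 c_eq0}.
- by move=> m m0 badmc; rewrite !sum_kl_gap_swap sE /kl_gap; ring.
Qed.

End KullbackLeibler.

(** * Evaluation of the perspectives *)

Section Perspectives.
Context {R : realType}.
Implicit Types (f g : R -> R) (a b s t alpha k : R) (v w : \bar R).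

Lemma cvg_inv_at_right0 : s^-1 @[s --> +oo] --> (0 : R)^'+.
Proof.
move=> P [e /= e0 Pe]; exists e^-1; split; first exact: num_real.
move=> s es; have s0 : 0 < s by apply: lt_trans es; rewrite invr_gt0.
apply: Pe => /=; last by rewrite invr_gt0.
by rewrite sub0r normrN gtr0_norm ?invr_gt0// invf_plt ?posrE.
Qed.

Lemma eq_cvg_at_right0 (F G : R -> \bar R) v :
  (forall s, 0 < s -> F s = G s) ->
  G s @[s --> 0^'+] --> v -> F s @[s --> 0^'+] --> v.
Proof.
move=> FG; apply: cvg_trans; apply: near_eq_cvg.
by near=> s; rewrite FG//; near: s; exact: nbhs_right_gt.
Unshelve. all: by end_near. Qed.

(** Substituting [s^-1] for [s] turns the slope at infinity into a limit at 0 of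
    t f(1 / t), the function whose perspective has the arguments exchanged;
    all limits are then taken at the same place. *)
Lemma perspectiveE f v w a b :
  (f s)%:E @[s --> 0^'+] --> v ->
  (s * f s^-1)%:E @[s --> 0^'+] --> w ->
  perspective f a b = (if b == 0%R then a%:E * w
    else if a == 0%R then b%:E * v else (b * f (a / b)%R)%:E)%E.
Proof.
move=> fv fw; rewrite /perspective /value_ext mulf_eq0 invr_eq0.
have -> : slope_at_infinity f = w.
  apply: cvg_lim; first exact: ereal_hausdorff.
  rewrite (_ : (fun s => _) = (fun s => (s * f s^-1)%:E) \o GRing.inv).
    exact: cvg_comp cvg_inv_at_right0 fw.
  by apply/funext => s /=; rewrite invrK mulrC.
case: (eqVneq b 0) => //= bn0; rewrite orbF.
by case: (eqVneq a 0) => // _; congr (_ * _)%E; exact: cvg_lim fv.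
Qed.

Lemma cvg_alpha_fun_at_right0 k alpha : 0 < k -> alpha != 0 -> alpha != 1 ->
  (k * alpha_fun alpha s)%:E @[s --> 0^'+] -->
  (if (alpha < 0)%R then +oo else (k / alpha)%:E)%E.
Proof.
move=> k0 al0 al1; have al1' : alpha - 1 != 0 by rewrite subr_eq0.
have [al_lt0|al_ge0] := ltP alpha 0; last first.
  have al_gt0 : 0 < alpha by rewrite lt_def al0.
  apply/cvg_EFin; first by near=> s.
  have -> : k / alpha = k * ((0 - alpha * 0 - (1 - alpha)) / (alpha * (alpha - 1))).
    by field; rewrite al1' al0.
  apply: cvgM; first exact: cvg_cst.
  apply: cvgM; last exact: cvg_cst.
  apply: cvgB; last exact: cvg_cst.
  apply: cvgB; first exact: powR_cvg0.
  apply: cvgM; first exact: cvg_cst.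
  exact: cvg_at_right_filter cvg_id.
apply/cvgeryP; apply: gt0_cvgMry => //; apply/cvgryPge => A.
have D0 : 0 < alpha * (alpha - 1) by rewrite nmulr_rgt0// subr_lt0 (lt_trans al_lt0).
have : s `^ alpha @[s --> 0^'+] --> +oo.
  have : (s `^ (- alpha))^-1 @[s --> 0^'+] --> +oo.
    apply/cvgrVy; last by apply: powR_cvg0; rewrite oppr_gt0.
    by near=> s; apply: powR_gt0; near: s; exact: nbhs_right_gt.
  by apply: cvg_trans; apply: near_eq_cvg; near=> s; rewrite /= powRN invrK.
move=> /cvgryPge/(_ (A * (alpha * (alpha - 1)) + (1 - alpha))) powge.
near=> s; have s0 : 0 < s by near: s; exact: nbhs_right_gt.
rewrite /alpha_fun ler_pdivlMr//.
have : A * (alpha * (alpha - 1)) + (1 - alpha) <= s `^ alpha by near: s.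
have : alpha * s < 0 by rewrite nmulr_rlt0.
by lra.
Unshelve. all: by end_near. Qed.

(** The limit at infinity is the limit at 0 for [1 - alpha], because
    s f_alpha(1 / s) = f_(1 - alpha)(s). *)
Lemma perspective_power f k alpha a b : 0 < k -> alpha != 0 -> alpha != 1 ->
  (forall s, 0 < s -> f s = k * alpha_fun alpha s) ->
  0 <= a -> 0 <= b -> perspective f a b = power_divergence k alpha a b.
Proof.
move=> k0 al0 al1 fE a0 b0; have al1' : alpha - 1 != 0 by rewrite subr_eq0.
have nal0 : 1 - alpha != 0 by rewrite subr_eq0 eq_sym.
have nal1 : 1 - alpha != 1 by rewrite -subr_eq0 (_ : _ - 1 = - alpha) ?oppr_eq0//; ring.
rewrite (perspectiveE a b
  (eq_cvg_at_right0 _ (cvg_alpha_fun_at_right0 k0 al0 al1))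
  (eq_cvg_at_right0 _ (cvg_alpha_fun_at_right0 k0 nal0 nal1))); last 2 first.
  by move=> s s0; rewrite fE.
  move=> s s0; rewrite fE ?invr_gt0// /alpha_fun; congr (_%:E).
  have -> : s `^ (1 - alpha) = s * s^-1 `^ alpha.
    rewrite -[s^-1]powR_inv1 ?(ltW s0)// -powRrM mulN1r -{2}[s]powRr1 ?(ltW s0)//.
    by rewrite -powRD ?(gt_eqF s0) ?implybT//.
  by field; rewrite nal0 al1' al0 (_ : 1 - alpha - 1 = - alpha) ?oppr_eq0 ?al0 ?gt_eqF//; ring.
rewrite subr_lt0 /power_divergence /extended_gap /power_infinite /power_gap.
have [->|bn0] := eqVneq b 0.
  have [->|an0]/= := eqVneq a 0.
    by rewrite mul0e !andbF/= powR0// powR0//; congr (_%:E); ring.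
  rewrite !andbF andbT/= ltNge; case: leP => al_le1 /=; last first.
    by rewrite gt0_muley// lte_fin lt_def an0.
  by rewrite -EFinM powR0//; congr (_%:E); field; rewrite nal0 al1' al0.
rewrite andbF orbF andbT; have [->|an0]/= := eqVneq a 0.
  rewrite andbT; case: ltP => al_ge0 /=.
    by rewrite gt0_muley// lte_fin lt_def bn0.
  by rewrite -EFinM powR0//; congr (_%:E); field; rewrite al1' al0.
rewrite andbF/=; have ap : 0 < a by rewrite lt_def an0.
have bp : 0 < b by rewrite lt_def bn0.
rewrite fE ?divr_gt0// /alpha_fun; congr (_%:E).
have -> : b `^ (1 - alpha) = b * b^-1 `^ alpha.
  rewrite -[b^-1]powR_inv1// -powRrM mulN1r -{2}[b]powRr1//.
  by rewrite -powRD ?bn0 ?implybT//.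
by rewrite powRM ?invr_ge0//; field; rewrite bn0 al0 al1'.
Qed.

Lemma perspective_kl a b :
  0 <= a -> 0 <= b -> perspective kl_fun a b = kl_divergence a b.
Proof.
move=> a0 b0.
have value0 : (kl_fun s)%:E @[s --> (0:R)^'+] --> (1%:E : \bar R).
  apply/cvg_EFin; first by near=> s.
  rewrite -[X in _ --> X](_ : 0 - 0 + 1 = 1); last by ring.
  apply: cvgD; last exact: cvg_cst.
  apply: cvgB; last exact: cvg_at_right_filter cvg_id.
  apply: (@squeeze_cvgr _ _ _ _ (fun s => - (2 * s `^ 2^-1)) (cst 0)).
  - near=> s; have s0 : 0 < s by near: s; exact: nbhs_right_gt.
    have s1 : s < 1 by near: s; exact: nbhs_right_lt.
    apply/andP; split; last first.
      by rewrite pmulr_rle0// ltW// ln_lt0// s0.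
    (* [ln x < x] at [x = s `^ (- 1 / 2)] gives - s ln s < 2 sqrt s. *)
    have := ln_sublinear (powR_gt0 (- 2^-1) s0); rewrite ln_powR.
    rewrite -(ltr_pM2l s0) => /ltW.
    have -> : s * s `^ (- 2^-1) = s `^ 2^-1.
      rewrite -{1}[s]powRr1 ?(ltW s0)// -powRD ?(gt_eqF s0) ?implybT//.
      by congr (_ `^ _); field.
    by lra.
  - rewrite -[X in _ --> X]oppr0 -[X in - X](mulr0 2).
    by apply: cvgN; apply: cvgM; [exact: cvg_cst|apply: powR_cvg0].
  - exact: cvg_cst.
have slope : (s * kl_fun s^-1)%:E @[s --> (0:R)^'+] --> (+oo : \bar R)%E.
  apply/cvgeryP/cvgryPge => A.
  have /cvgrNyPle/(_ (- A - 1)) lnle := @lnNy R.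
  near=> s; have s0 : 0 < s by near: s; exact: nbhs_right_gt.
  have : ln s <= - A - 1 by near: s.
  rewrite /kl_fun lnV ?posrE//.
  have -> : s * (s^-1 * - ln s - s^-1 + 1) = - ln s - 1 + s.
    by field; rewrite gt_eqF.
  by lra.
rewrite (perspectiveE a b value0 slope) /kl_divergence /extended_gap.
rewrite /kl_infinite /kl_gap /kl_fun.
have [->|bn0]/= := eqVneq b 0.
  have [->|an0]/= := eqVneq a 0; first by rewrite mul0e; congr (_%:E); ring.
  by rewrite gt0_muley// lte_fin lt_def an0.
have [->|an0] := eqVneq a 0; first by rewrite -EFinM; congr (_%:E); ring.
rewrite ln_div ?posrE ?lt_def ?an0 ?bn0//.
by congr (_%:E); field.
Unshelve. all: by end_near. Qed.

End Perspectives.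

(** * Projections and centroids *)

Section Centroids.
Context {R : realType} {X : finType}.
Implicit Types (d : R -> R -> \bar R) (f : R -> R) (pi : X -> R).
Implicit Types (alpha p k : R) (s : seq R).

Definition barycentric_mean d (mu : seq R -> R) : Prop :=
  forall s, s != [::] -> (forall b, b \in s -> 0 <= b) -> barycenter d s (mu s).

Lemma eq_barycentric_mean d1 d2 (mu : seq R -> R) :
  (forall a b, 0 <= a -> 0 <= b -> d1 a b = d2 a b) ->
  barycentric_mean d2 mu -> barycentric_mean d1 mu.
Proof.
by move=> d12 bary s s0 sge0; apply: (eq_barycenter d12) => //; apply: bary.
Qed.

Lemma eq_with_zero_row_sums (off1 off2 : X -> X -> R) :
  (forall x y, y != x -> off1 x y = off2 x y) ->
  with_zero_row_sums off1 = with_zero_row_sums off2.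
Proof.
move=> off12; apply/funext => x; apply/funext => y; rewrite /with_zero_row_sums.
case: eqVneq => [_|xy]; last by rewrite off12// eq_sym.
by congr (- _); apply: eq_bigr => z; apply: off12.
Qed.

Lemma mean_projections_centroid d (mu : seq R -> R) pi n
    (L : 'I_n -> X -> X -> R) :
  divergence d -> barycentric_mean d mu -> (forall x, 0 < pi x) ->
  (0 < n)%N -> (forall i, generators (L i)) ->
  let P i := with_zero_row_sums (fun x y => mu [:: L i x y; dual pi (L i) x y]) in
  [/\ forall i, reversible_generators pi (P i),
      forall i, argmin (reversible_generators pi)
        (fun M => total_divergence d pi M (L i)) = [set P i] &
      argmin (reversible_generators pi)
        (fun M => \sum_(i < n) total_divergence d pi M (L i))%E =
      [set with_zero_row_sums (fun x y => mu [seq P i x y | i <- enum 'I_n])]].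
Proof.
move=> dP mean pi0 n0 Lg P.
have baryL i : pairwise_barycenter d pi (L i)
    (fun x y => mu [:: L i x y; dual pi (L i) x y]).
  move=> x y yx; apply: mean => // b; rewrite !inE => /orP[] /eqP ->.
    exact: generators_offdiag_ge0.
  exact: dual_offdiag_ge0.
have Prev i : reversible_generators pi (P i).
  exact: pairwise_barycenter_reversible (baryL i).
split=> // [i|]; first exact: projection_pairwise_barycenter.
apply: (centroid_of_projections (P := P)) => // [i x y yx|x y yx].
  by rewrite /P with_zero_row_sums_offdiag//; apply: baryL.
apply: mean; first by rewrite -size_eq0 size_map size_enum_ord -lt0n.
move=> _ /mapP[i _ ->]; have [Pg _] := Prev i.
exact: generators_offdiag_ge0.
Qed.

Lemma power_reversiblizationE p pi (L : X -> X -> R) : p != 0 ->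
  power_reversiblization pi p L =
  with_zero_row_sums (fun x y => seq_power_mean p [:: L x y; dual pi L x y]).
Proof.
move=> p0; apply: eq_with_zero_row_sums => x y _.
rewrite (negPf p0) /seq_power_mean !inE !(eq_sym 0); case: ifP => // _.
by rewrite big_cons big_seq1 mulrC.
Qed.

Lemma power_meanE p n (a : 'I_n -> R) :
  power_mean p a = seq_power_mean p [seq a i | i <- enum 'I_n].
Proof.
rewrite /power_mean /seq_power_mean size_map size_enum_ord big_map big_enum/=.
congr (if _ && _ then _ else _); apply/existsP/mapP => [[i /eqP ai]|[i _ ai]].
  by exists i; rewrite ?mem_enum.
by exists i; rewrite -ai.
Qed.

(** The exponent [p] is kept apart from [1 - alpha] so that it can be given in
    simplified form.  Reversibility of the projections is recorded because it
    makes their off-diagonal entries nonnegative, which is what turns powers of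
    exponent 2 and 1/2 of these entries into squares and square roots. *)
Lemma power_projections_centroids f k alpha p pi n (L : 'I_n -> X -> X -> R) :
  0 < k -> alpha != 0 -> alpha != 1 -> p = 1 - alpha ->
  (forall t, 0 < t -> f t = k * alpha_fun alpha t) ->
  (forall x, 0 < pi x) -> (0 < n)%N -> (forall i, generators (L i)) ->
  let Mf i := power_reversiblization pi p (L i) in
  let Mfs i := power_reversiblization pi alpha (L i) in
  [/\ forall i, reversible_generators pi (Mf i) /\
        f_projections f pi (L i) = [set Mf i],
      forall i, reversible_generators pi (Mfs i) /\
        fstar_projections f pi (L i) = [set Mfs i],
      f_centroids f pi L = [set with_zero_row_sums
        (fun x y => power_mean p (fun i => Mf i x y))] &
      fstar_centroids f pi L = [set with_zero_row_sums
        (fun x y => power_mean alpha (fun i => Mfs i x y))]].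
Proof.
move=> k0 al0 al1 pE fE pi0 n0 Lg Mf Mfs.
have p0 : p != 0 by rewrite pE subr_eq0 eq_sym.
have p1 : p != 1 by rewrite -subr_eq0 pE (_ : _ - 1 = - alpha) ?oppr_eq0//; ring.
have alE : alpha = 1 - p by rewrite pE; ring.
have fpersp a b : 0 <= a -> 0 <= b ->
    perspective f a b = power_divergence k alpha a b.
  by move=> a0 b0; apply: perspective_power.
have fspersp a b : 0 <= a -> 0 <= b ->
    perspective f b a = power_divergence k p a b.
  by move=> a0 b0; rewrite fpersp// pE power_divergence_swap.
have meanf : barycentric_mean (perspective f) (seq_power_mean p).
  apply: (eq_barycentric_mean fpersp) => s; rewrite pE.
  exact: barycenter_power.
have meanfs : barycentric_mean (fun a b => perspective f b a) (seq_power_mean alpha).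
  apply: (eq_barycentric_mean fspersp) => s; rewrite alE.
  exact: barycenter_power.
have divf := eq_divergence fpersp (divergence_power k0 al0 al1).
have divfs := eq_divergence fspersp (divergence_power k0 p0 p1).
have [revf projf centf] := mean_projections_centroid divf meanf pi0 n0 Lg.
have [revfs projfs centfs] := mean_projections_centroid divfs meanfs pi0 n0 Lg.
split.
- move=> i; rewrite /Mf (power_reversiblizationE _ _ p0).
  split; [exact: revf|exact: projf].
- move=> i; rewrite /Mfs (power_reversiblizationE _ _ al0).
  split; [exact: revfs|exact: projfs].
- rewrite [LHS]centf; congr [set with_zero_row_sums _].
  apply/funext => x; apply/funext => y; rewrite power_meanE.
  by under [in RHS]eq_map => i do rewrite /Mf power_reversiblizationE//.
- rewrite [LHS]centfs; congr [set with_zero_row_sums _].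
  apply/funext => x; apply/funext => y; rewrite power_meanE.
  by under [in RHS]eq_map => i do rewrite /Mfs power_reversiblizationE//.
Qed.

Lemma kl_projections_centroids pi n (L : 'I_n -> X -> X -> R) :
  (forall x, 0 < pi x) -> (0 < n)%N -> (forall i, generators (L i)) ->
  let Mf i := power_reversiblization pi 0 (L i) in
  let Mfs i := power_reversiblization pi 1 (L i) in
  [/\ forall i, f_projections kl_fun pi (L i) = [set Mf i],
      forall i, fstar_projections kl_fun pi (L i) = [set Mfs i],
      f_centroids kl_fun pi L = [set with_zero_row_sums
        (fun x y => (\prod_(i < n) Mf i x y) `^ (n%:R^-1))] &
      fstar_centroids kl_fun pi L = [set with_zero_row_sums
        (fun x y => n%:R^-1 * \sum_(i < n) Mfs i x y)]].
Proof.
move=> pi0 n0 Lg Mf Mfs.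
have MfE i : Mf i = with_zero_row_sums
    (fun x y => seq_geometric_mean [:: L i x y; dual pi (L i) x y]).
  apply: eq_with_zero_row_sums => x y yx; rewrite eqxx /seq_geometric_mean.
  rewrite big_cons big_seq1 powR12_sqrt// mulr_ge0//.
    exact: generators_offdiag_ge0.
  exact: dual_offdiag_ge0.
have MfsE i : Mfs i = with_zero_row_sums
    (fun x y => seq_arithmetic_mean [:: L i x y; dual pi (L i) x y]).
  apply: eq_with_zero_row_sums => x y yx.
  have L0 : 0 <= L i x y by apply: generators_offdiag_ge0.
  have Ld0 : 0 <= dual pi (L i) x y by apply: dual_offdiag_ge0.
  rewrite oner_eq0 ltNge ler01/= invr1 !powRr1// ?divr_ge0 ?addr_ge0//.
  by rewrite /seq_arithmetic_mean big_cons big_seq1 mulrC.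
have fpersp := @perspective_kl R.
have fspersp (a b : R) : 0 <= a -> 0 <= b -> perspective kl_fun b a = kl_divergence b a.
  by move=> a0 b0; apply: perspective_kl.
have [_ projf centf] := mean_projections_centroid
  (eq_divergence fpersp divergence_kl)
  (eq_barycentric_mean fpersp barycenter_kl) pi0 n0 Lg.
have [_ projfs centfs] := mean_projections_centroid
  (eq_divergence fspersp (divergence_swap divergence_kl))
  (eq_barycentric_mean fspersp barycenter_kl_swap) pi0 n0 Lg.
split.
- by move=> i; rewrite MfE; apply: projf.
- by move=> i; rewrite MfsE; apply: projfs.
- rewrite [LHS]centf; congr [set with_zero_row_sums _].
  apply/funext => x; apply/funext => y.
  rewrite /seq_geometric_mean size_map size_enum_ord big_map big_enum/=.
  by under [in RHS]eq_bigr do rewrite MfE.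
- rewrite [LHS]centfs; congr [set with_zero_row_sums _].
  apply/funext => x; apply/funext => y.
  rewrite /seq_arithmetic_mean size_map size_enum_ord big_map big_enum/=.
  by under [in RHS]eq_bigr do rewrite MfsE.
Qed.

Lemma chi2_funE (t : R) : 0 < t -> chi2_fun t = 2 * alpha_fun 2 t.
Proof.
move=> t0; rewrite /chi2_fun /alpha_fun powR_mulrn ?(ltW t0)//.
by field.
Qed.

Lemma hellinger_funE (t : R) :
  0 < t -> hellinger_fun t = 1 / 2 * alpha_fun (1 / 2) t.
Proof.
move=> t0; rewrite /hellinger_fun /alpha_fun !div1r powR12_sqrt ?(ltW t0)//.
rewrite -{3}(sqr_sqrtr (ltW t0)).
by field.
Qed.

Lemma power_mean_2 n (a : 'I_n -> R) : (forall i, 0 <= a i) ->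
  power_mean 2 a = Num.sqrt (n%:R^-1 * \sum_(i < n) a i ^+ 2).
Proof.
move=> a0; rewrite /power_mean ltNge ler0n/=.
under eq_bigr do rewrite powR_mulrn//.
by rewrite powR12_sqrt// mulr_ge0// sumr_ge0// => i _; apply: sqr_ge0.
Qed.

Lemma power_mean_half n (a : 'I_n -> R) : (forall i, 0 <= a i) ->
  power_mean (1 / 2) a = (n%:R^-1 * \sum_(i < n) Num.sqrt (a i)) ^+ 2.
Proof.
move=> a0; rewrite /power_mean ltNge divr_ge0//= div1r invrK.
under eq_bigr do rewrite powR12_sqrt//.
by rewrite powR_mulrn// mulr_ge0// sumr_ge0// => i _; apply: sqrtr_ge0.
Qed.

End Centroids.

Theorem theorem3p10 (R : realType) (X : finType) (pi : X -> R)
    (pi_gt0 : forall x, 0 < pi x) (pi_sum : \sum_(x : X) pi x = 1)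
    (n : nat) (n_gt0 : (0 < n)%N) (L : 'I_n -> X -> X -> R)
    (L_gen : forall i, generators (L i)) :
  [/\
    forall alpha : R, alpha != 0 -> alpha != 1 ->
      let f := alpha_fun alpha in
      let Mf i := power_reversiblization pi (1 - alpha) (L i) in
      let Mfs i := power_reversiblization pi alpha (L i) in
      [/\ forall i, f_projections f pi (L i) = [set Mf i],
          forall i, fstar_projections f pi (L i) = [set Mfs i],
          f_centroids f pi L = [set with_zero_row_sums
            (fun x y => power_mean (1 - alpha) (fun i => Mf i x y))] &
          fstar_centroids f pi L = [set with_zero_row_sums
            (fun x y => power_mean alpha (fun i => Mfs i x y))]],
    let f := chi2_fun in
    let Mf i := power_reversiblization pi (-1) (L i) in
    let Mfs i := power_reversiblization pi 2 (L i) in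
    [/\ forall i, f_projections f pi (L i) = [set Mf i],
        forall i, fstar_projections f pi (L i) = [set Mfs i],
        f_centroids f pi L = [set with_zero_row_sums
          (fun x y => power_mean (-1) (fun i => Mf i x y))] &
        fstar_centroids f pi L = [set with_zero_row_sums
          (fun x y => Num.sqrt (n%:R^-1 * \sum_(i < n) Mfs i x y ^+ 2))]],
    let f := hellinger_fun in
    let Mf i := power_reversiblization pi (1 / 2) (L i) in
    [/\ forall i, f_projections f pi (L i) = [set Mf i],
        forall i, fstar_projections f pi (L i) = [set Mf i],
        f_centroids f pi L = [set with_zero_row_sums
          (fun x y => (n%:R^-1 * \sum_(i < n) Num.sqrt (Mf i x y)) ^+ 2)] &
        fstar_centroids f pi L = [set with_zero_row_sums
          (fun x y => (n%:R^-1 * \sum_(i < n) Num.sqrt (Mf i x y)) ^+ 2)]] &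
    let f := kl_fun in
    let Mf i := power_reversiblization pi 0 (L i) in
    let Mfs i := power_reversiblization pi 1 (L i) in
    [/\ forall i, f_projections f pi (L i) = [set Mf i],
        forall i, fstar_projections f pi (L i) = [set Mfs i],
        f_centroids f pi L = [set with_zero_row_sums
          (fun x y => (\prod_(i < n) Mf i x y) `^ (n%:R^-1))] &
        fstar_centroids f pi L = [set with_zero_row_sums
          (fun x y => n%:R^-1 * \sum_(i < n) Mfs i x y)]]].

Proof.
split.
- move=> alpha al0 al1 f Mf Mfs.
  have [projf projfs centf centfs] := @power_projections_centroids R X f 1 alpha
    (1 - alpha) pi n L ltr01 al0 al1 erefl (fun s _ => esym (mul1r _)) pi_gt0
    n_gt0 L_gen.
  split.
  - by move=> i; case: (projf i).
  - by move=> i; case: (projfs i).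
  - exact: centf.
  - exact: centfs.
- move=> f Mf Mfs.
  have two0 : (0 : R) < 2 by [].
  have two_neq0 : (2 : R) != 0 by rewrite pnatr_eq0.
  have two_neq1 : (2 : R) != 1 by rewrite gt_eqF// ltr1n.
  have p_chi2 : (-1 : R) = 1 - 2 by ring.
  have [projf projfs centf centfs] := power_projections_centroids two0
    two_neq0 two_neq1 p_chi2 (@chi2_funE R) pi_gt0 n_gt0 L_gen.
  split.
  - by move=> i; case: (projf i).
  - by move=> i; case: (projfs i).
  - exact: centf.
  rewrite [LHS]centfs; congr [set _].
  apply: eq_with_zero_row_sums => x y yx; apply: power_mean_2 => i.
  by have [[/generators_offdiag_ge0 + _] _] := projfs i; apply.
- move=> f Mf.
  have half0 : (0 : R) < 1 / 2 by lra.
  have half_neq0 : (1 / 2 : R) != 0 by rewrite gt_eqF.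
  have half_neq1 : (1 / 2 : R) != 1 by rewrite lt_eqF//; lra.
  have p_half : (1 / 2 : R) = 1 - 1 / 2 by field.
  have [projf projfs centf centfs] := power_projections_centroids half0
    half_neq0 half_neq1 p_half (@hellinger_funE R) pi_gt0 n_gt0 L_gen.
  have Mf_ge0 x y : y != x -> forall i, 0 <= Mf i x y.
    move=> yx i; have [[/generators_offdiag_ge0 + _] _] := projf i.
    by apply.
  have halfE : with_zero_row_sums (fun x y => power_mean (1 / 2) (fun i => Mf i x y)) =
      with_zero_row_sums
        (fun x y => (n%:R^-1 * \sum_(i < n) Num.sqrt (Mf i x y)) ^+ 2).
    apply: eq_with_zero_row_sums => x y yx; apply: power_mean_half => i.
    exact: Mf_ge0.
  split; rewrite -?halfE.
  - by move=> i; case: (projf i).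
  - by move=> i; case: (projfs i).
  - exact: centf.
  - exact: centfs.
- exact: kl_projections_centroids.
Qed.
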